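(* An $n$-maniplex $\mathcal{M}$ has the component intersection property if and only if it has the weak path intersection property.
   Context: Write $[n]=\{0,1,\dots,n-1\}$. An $n$-maniplex is a simple graph $\mathcal{M}$ whose edges are coloured with colours from $[n]$ so that every vertex (called a flag) is incident to exactly one edge of each colour, and such that for all $i,j\in[n]$ with $|i-j|>1$, every connected component of the subgraph formed by all vertices and the edges of colours $i$ and $j$ is a $4$-cycle. For $A\subset[n]$, $\mathcal{M}_A$ denotes the spanning subgraph with exactly the edges with colours in $A$. For $i\in[n]$, an $i$-face of $\mathcal{M}$ is a connected component of $\mathcal{M}_{[n]\setminus\{i\}}$ (a subgraph of $\mathcal{M}$); it has rank $i$. The poset $\mathcal{P}_\mathcal{M}$ consists of all faces of $\mathcal{M}$ together with a minimum $F_{-1}$ and a maximum $F_n$; for an $i$-face $F$ and a $j$-face $G$ of $\mathcal{M}$, $F\le G$ iff $i\le j$ and $F\cap G\neq\emptyset$. $\mathcal{M}$ has the component intersection property (CIP) if for every chain $\{G_1,\dots,G_k\}$ of faces of $\mathcal{M}$ in $\mathcal{P}_\mathcal{M}$, the subgraph $\bigcap_{j=1}^kG_j$ of $\mathcal{M}$ is connected. $\mathcal{M}$ has the weak path intersection property (WPIP) if for any two different flags $u,v$ and any $i,j\in[n]$ with $i<j$: whenever there is a $u$–$v$ path using only colours in $\{k\in[n]:k>i\}$ and a $u$–$v$ path using only colours in $\{k\in[n]:k<j\}$, there is a $u$–$v$ path using only colours in $\{k\in[n]: i<k<j\}$. *)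

(* Defs.v *)
From mathcomp Require Import all_boot.
From mathcomp Require Import boolp classical_sets.
From Stdlib Require List.

Set Implicit Arguments.
Unset Strict Implicit.
Unset Printing Implicit Defensive.

Local Open Scope classical_set_scope.

(* Graphs with vertices taken from an ambient type V; V may be infinite. *)
Record graph (V : Type) := Graph {
  vert : set V;
  edge : V -> V -> Prop
}.

Section Graphs.
Variable V : Type.
Implicit Types (G H : graph V) (u v : V) (s : seq V).

Fixpoint walk (e : V -> V -> Prop) u s : Prop :=
  if s is v :: s' then e u v /\ walk e v s' else True.

Definition is_path G u v s : Prop :=
  [/\ vert G u, walk (edge G) u s, last u s = v & List.NoDup (u :: s)].

Definition joined G u v : Prop := exists s, is_path G u v s.

Definition connected G : Prop :=
  vert G !=set0 /\ forall u v, vert G u -> vert G v -> joined G u v.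

Definition component G u : graph V :=
  Graph [set v | joined G u v]
        (fun v w => [/\ joined G u v, joined G u w & edge G v w]).

Definition is_component G H : Prop := exists2 u, vert G u & H = component G u.

Definition meet_graph G H : graph V :=
  Graph (vert G `&` vert H) (fun u v => edge G u v /\ edge H u v).

Definition bigmeet_graph k (G : 'I_k.+1 -> graph V) : graph V :=
  Graph (\bigcap_j vert (G j)) (fun u v => forall j, edge (G j) u v).

(* [ordS] is the cyclic successor on 'I_m, so f enumerates the cycle; this is
   the usual notion for m >= 3. *)
Definition is_cycle m G : Prop :=
  exists f : 'I_m -> V,
    [/\ injective f,
        vert G = range f &
        forall u v, edge G u v <->
          exists a, (u = f a /\ v = f (ordS a)) \/ (v = f a /\ u = f (ordS a))].

(* If [adj i u v] says that u and v are joined by an edge of colour i, this is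
   the spanning subgraph formed by the edges with colours in A. *)
Definition colour_graph n (adj : 'I_n -> V -> V -> Prop) (A : set 'I_n) :
    graph V :=
  Graph setT (fun u v => exists2 i, A i & adj i u v).

End Graphs.

(* [adj_simple]: an edge of a simple graph carries a single colour. *)
Record maniplex (n : nat) := Maniplex {
  flag :> Type;
  adj : 'I_n -> flag -> flag -> Prop;
  adj_sym : forall i u v, adj i u v -> adj i v u;
  adj_irr : forall i u, ~ adj i u u;
  adj_simple : forall i j u v, adj i u v -> adj j u v -> i = j;
  adj_uniq : forall i u, exists! v, adj i u v;
  adj_4cycle : forall i j : 'I_n, (i.+1 < j)%N \/ (j.+1 < i)%N ->
    forall C, is_component (colour_graph adj [set i; j]) C -> is_cycle 4 C
}.

Section Maniplex.
Variables (n : nat) (M : maniplex n).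

Definition restr (A : set 'I_n) : graph M := colour_graph (@adj n M) A.

(* Faces of different ranks are different subgraphs (every flag of an i-face
   lies on edges of all colours but i), so recording the rank does not
   duplicate faces. *)
Record face := Face {
  rank : 'I_n;
  face_graph : graph M;
  faceP : is_component (restr (~` [set rank])) face_graph
}.

Inductive poset_elt := FMin | FProper of face | FMax.

Definition poset_le (x y : poset_elt) : Prop :=
  match x, y with
  | FMin, _ => True
  | _, FMax => True
  | FProper F, FProper G =>
      (rank F <= rank G)%N /\
      vert (meet_graph (face_graph F) (face_graph G)) !=set0
  | _, _ => False
  end.

(* The faces G_1, ..., G_k of a chain are given as a nonempty finite family. *)
Definition is_chain k (G : 'I_k.+1 -> face) : Prop :=
  forall a b, poset_le (FProper (G a)) (FProper (G b)) \/
              poset_le (FProper (G b)) (FProper (G a)).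

Definition CIP : Prop :=
  forall k (G : 'I_k.+1 -> face), is_chain G ->
    connected (bigmeet_graph (fun a => face_graph (G a))).

Definition WPIP : Prop :=
  forall (u v : M) (i j : 'I_n), u <> v -> (i < j)%N ->
    joined (restr [set k : 'I_n | (i < k)%N]) u v ->
    joined (restr [set k : 'I_n | (k < j)%N]) u v ->
    joined (restr [set k : 'I_n | (i < k < j)%N]) u v.

End Maniplex.

(* Main.v *)
(** Colours on either side of a rank [r] commute, so a walk avoiding [r] can be
    rearranged to use first the colours on one side of [r] and then those on the
    other.

    From WPIP to CIP, order the ranks occurring in the chain and add the faces
    one at a time, the face [F] of rank [r] being followed by [G] of rank [s].
    Common flags: if [u] lies in the faces up to [F] and [w] in [F] and [G],
    rearrange a walk from [u] to [w] in [F] as [u ~> x ~> w] with colours above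
    and then below [r]; [x] lies in all the faces.
    Connectedness: let [u] and [v] be common flags.  A walk between them which
    avoids the ranks up to [r] becomes [u ~> x ~> v] with colours above and then
    below [r], so [x] lies in [G], and [u], [x] are joined in [G] by a walk
    [u ~> y ~> x] with colours below and then above [s].  Now [u] and [y] are
    joined by colours below [s] and also (through [x]) by colours above [r],
    hence by WPIP by colours strictly in between.

    Conversely, apply CIP to the faces of [u] whose ranks are outside the open
    interval from [i] to [j]. *)
From mathcomp Require Import all_boot.
From mathcomp Require Import boolp classical_sets.
From mathcomp Require Import zify.
From Stdlib Require Import Relation_Operators.
From Stdlib Require List.
Require Import Defs.

Set Implicit Arguments.
Unset Strict Implicit.
Unset Printing Implicit Defensive.

Local Open Scope classical_set_scope.

(** * Paths and the closure of the edge relation *)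

Section Joined.
Variables (V : Type) (G : graph V).
Implicit Types (u v w : V) (s : seq V).

Lemma is_path_suffix w v s u : (forall x y, edge G x y -> vert G y) ->
  is_path G v w s -> List.In u (v :: s) -> joined G u w.
Proof.
move=> Gcl; elim: s v => [|x s IHs] v.
  by move=> vw [<-|[]]; exists [::].
move=> p [<-|us]; first by exists (x :: s).
case: p => [Gv [vx xs] lw /List.NoDup_cons_iff[_ nd]].
by apply: (IHs x) => //; split=> //; apply: Gcl vx.
Qed.

Lemma joinedP u v : (forall x y, edge G x y -> vert G y) ->
  joined G u v <-> vert G u /\ clos_refl_trans_1n V (edge G) u v.
Proof.
move=> Gcl; split.
  case=> s [Gu us <- _]; split=> //.
  elim: s u us {Gu} => [|x s IHs] u /=; first by constructor.
  by case=> ux /IHs; apply: rt1n_trans ux.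
case=> + uv; elim: uv => {u v} [u|u x v ux xv IH] Gu.
  by exists [::]; split=> //; repeat constructor=> //; case.
have [s p] := IH (Gcl _ _ ux).
have [us|us] := pselect (List.In u (x :: s)); first exact: is_path_suffix p us.
exists (x :: s); case: p => _ xs lv nd; split=> //; exact: List.NoDup_cons.
Qed.

End Joined.

(** * Walks with colours in a given set *)

Section Reach.
Variables (n : nat) (M : maniplex n).
Implicit Types (A B C : set 'I_n) (u v w x y : M) (i j r : 'I_n).

Definition reach A := clos_refl_trans_1n M (edge (restr M A)).

Lemma reach_refl A u : reach A u u.
Proof. exact: rt1n_refl. Qed.

Lemma reach_step A i u x v : A i -> adj i u x -> reach A x v -> reach A u v.
Proof. by move=> Ai ux; apply: rt1n_trans; exists i. Qed.

Lemma reach_trans A u x v : reach A u x -> reach A x v -> reach A u v.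
Proof.
by elim=> [//|{}u y {}x [i Ai uy] _ IH] /IH; apply: reach_step uy.
Qed.

Lemma reach_sym A u v : reach A u v -> reach A v u.
Proof.
elim=> [*|{}u y {}v [i Ai uy] _ IH]; first exact: reach_refl.
by apply: reach_trans IH (reach_step Ai (adj_sym uy) (reach_refl _ _)).
Qed.

Lemma reach_sub A B u v : A `<=` B -> reach A u v -> reach B u v.
Proof.
move=> AB; elim=> [*|{}u y {}v [i Ai uy] _]; first exact: reach_refl.
exact: reach_step (AB _ Ai) uy.
Qed.

Lemma joined_restrP A u v : joined (restr M A) u v <-> reach A u v.
Proof. by rewrite joinedP //; split=> [[]|]. Qed.

Lemma adj_fun i u v w : adj i u v -> adj i u w -> v = w.
Proof. by case: (adj_uniq i u) => x [_ ux] /ux <- /ux <-. Qed.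

Definition far i j := (i.+1 < j)%N \/ (j.+1 < i)%N.

(** The flags [u], [v], [w] are consecutive on a 4-cycle of colours [i] and [j]; [x] is its fourth
    vertex. *)
Lemma adj_comm i j u v w : far i j -> adj i u v -> adj j v w ->
  exists2 x, adj j u x & adj i x w.
Proof.
move=> fij uv vw.
have nij : i <> j by move=> ij; case: fij; rewrite ij; lia.
have uw : u <> w.
  by move=> uw; apply: nij; apply: adj_simple uv _; apply: adj_sym; rewrite uw.
pose K := colour_graph (@adj n M) [set i; j].
have Ki : reach [set i; j] u v.
  by apply: reach_step uv (reach_refl _ _); left.
have Kj : reach [set i; j] v w.
  by apply: reach_step vw (reach_refl _ _); right.
have cu : joined K u u by apply/joined_restrP/reach_refl.
have cv : joined K u v by apply/joined_restrP.
have cw : joined K u w by apply/joined_restrP/(reach_trans Ki Kj).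
have [f [finj _ fE]] : is_cycle 4 (component K u).
  by apply: (adj_4cycle fij); exists u.
pose E := edge (component K u).
have euv : E u v by split=> //; exists i => //; left.
have evw : E v w by split=> //; exists j => //; right.
have [x [vx ux xw]] : exists x, [/\ v <> x, E u x &
    E x w].
  have opp (a : 'I_4) : ordS (ordS (ordS (ordS a))) = a.
    by apply/val_inj; case: a => -[|[|[|[|]]]].
  have neq2 (a : 'I_4) : f a <> f (ordS (ordS a)).
    by move/finj/(congr1 val); case: a => -[|[|[|[|]]]].
  have next a : E (f a) (f (ordS a)).
    by apply/fE; exists a; left.
  have prev a : E (f (ordS a)) (f a).
    by apply/fE; exists a; right.
  (* If the enumeration [f] runs through the two edges in opposite directions, then [u = w];
     otherwise the vertex opposite to [v] is the witness. *)
  case/fE: euv => a [[ua va]|[va ua]]; case/fE: evw => b [[vb wb]|[wb vb]].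
  - have /finj ba : f b = f (ordS a) by rewrite -vb.
    exists (f (ordS (ordS (ordS a)))); rewrite ua va wb ba.
    by split; [exact: neq2|rewrite -{1}[a]opp; exact: prev|exact: prev].
  - have /finj /ordS_inj ba : f (ordS b) = f (ordS a) by rewrite -vb.
    by case: uw; rewrite ua wb ba.
  - have /finj ba : f b = f a by rewrite -vb.
    by case: uw; rewrite ua wb ba.
  - have /finj ab : f a = f (ordS b) by rewrite -va.
    exists (f (ordS (ordS a))); rewrite ua va wb ab.
    by split; [exact: neq2|exact: next|rewrite -{2}[b]opp; exact: next].
(* Colour [i] at [u] and colour [j] at [w] both lead to [v], so [v <> x] fixes the colours of the
   new edges. *)
exists x; [case: ux => _ _ [k [->|->]] //|case: xw => _ _ [k [->|->]] //].
  by move/(adj_fun uv).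
by move/adj_sym/(adj_fun (adj_sym vw)).
Qed.

Lemma reach_adj_swap i B u v x : (forall j, B j -> far i j) ->
  adj i u v -> reach B v x -> exists2 y, reach B u y & adj i y x.
Proof.
move=> Bi + vx; elim: vx u => {v x} [v|v w x [j Bj vw] _ IH] u uv.
  by exists u => //; apply: reach_refl.
have [u' uu' /IH[y u'y yx]] := adj_comm (Bi j Bj) uv vw.
by exists y => //; apply: (reach_step Bj uu').
Qed.

(** A step with colour in [C] is carried past the later steps with colours in [B] by completing
    4-cycles. *)
Lemma reach_split A B C u v : (forall i j, C i -> B j -> far i j) ->
  A `<=` B `|` C -> reach A u v -> exists2 x, reach B u x & reach C x v.
Proof.
move=> CB AU; elim=> {u v} [u|u w v [i /AU Ai uw] _ [x wx xv]].
  by exists u; apply: reach_refl.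
case: Ai => [Bi|Ci]; first by exists x => //; apply: (reach_step Bi uw).
have [y uy yx] := reach_adj_swap (CB i ^~ Ci) uw wx.
by exists y => //; apply: (reach_step Ci yx).
Qed.

End Reach.

(** * Faces and their intersections *)

Section Faces.
Variables (n : nat) (M : maniplex n).
Implicit Types (F : face M) (u v w : M).

Lemma face_reach F u v : vert (face_graph F) u ->
  vert (face_graph F) v <-> reach (~` [set rank F]) u v.
Proof.
case: F => r G [w _ eG] /=; rewrite eG => /joined_restrP wu.
split=> [/joined_restrP|uv]; first exact: reach_trans (reach_sym wu).
exact/joined_restrP/(reach_trans wu).
Qed.

Lemma face_edge F u v : edge (face_graph F) u v <->
  vert (face_graph F) u /\ exists2 i, i <> rank F & adj i u v.
Proof.
case: F => r G [w _ eG] /=; rewrite eG; split=> [[wu _ uv]|[wu uv]] //.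
split=> //; move/joined_restrP: wu => wu; apply/joined_restrP.
by apply: reach_trans wu _; apply: rt1n_trans uv (reach_refl _ _).
Qed.

Lemma face_stable F A u v : ~ A (rank F) -> reach A u v ->
  vert (face_graph F) u -> vert (face_graph F) v.
Proof.
move=> Ar uv Fu; apply/(face_reach _ Fu); apply: reach_sub uv => i Ai ir.
by apply: Ar; rewrite -ir.
Qed.

Definition face_at (r : 'I_n) u : face M :=
  @Face n M r (component (restr M (~` [set r])) u)
    (ex_intro2 _ _ u Logic.I erefl).

Lemma face_at_mem r u : vert (face_graph (face_at r u)) u.
Proof. by apply/joined_restrP/reach_refl. Qed.

Lemma bigmeet_face_joined k (G : 'I_k.+1 -> face M) u v :
  joined (bigmeet_graph (fun a => face_graph (G a))) u v <->
  (forall a, vert (face_graph (G a)) u) /\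
  reach [set i | forall a, i <> rank (G a)] u v.
Proof.
rewrite joinedP; last first.
  move=> x y /= xy a _; have /face_edge[Gx [i ir ixy]] := xy a.
  by apply/(face_reach _ Gx); apply: (reach_step ir ixy); apply: reach_refl.
split=> [[Gu uv]|[Gu uv]]; (split; first by move=> a *; exact: Gu).
  elim: uv {Gu} => [*|x y z xy _]; first exact: reach_refl.
  (* Each face provides its own colour for this edge; [adj_simple] identifies them all. *)
  have /face_edge[_ [i _ ixy]] := xy ord0.
  apply: (reach_step _ ixy) => a.
  have /face_edge[_ [j jr /(adj_simple ixy) ->]] := xy a; exact: jr.
elim: uv Gu => [*|x y z [i Ai ixy] _ IH Gx]; first exact: rt1n_refl.
apply: (@rt1n_trans _ _ _ y) => [a|].
  by apply/face_edge; split=> //; exists i.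
apply: IH => a; apply/(face_reach _ (Gx a)).
by apply: (reach_step (Ai a) ixy); apply: reach_refl.
Qed.

End Faces.

(** Replaces sorting the chain: [b] attains the value of [r] just below [r a], and values may
    repeat. *)
Lemma finite_rank_ind k (r : 'I_k.+1 -> nat) (P : 'I_k.+1 -> Prop) :
  (forall a, (forall c, r a <= r c)%N -> P a) ->
  (forall a b, (r b < r a)%N -> (forall c, r c < r a -> r c <= r b)%N ->
     P b -> P a) ->
  forall a, P a.
Proof.
move=> P0 PS a; have [m] := ubnP (r a); elim: m a => // m IH a am.
have [/existsP[b0 b0a]|/existsPn ra] := boolP [exists b, r b < r a]%N; last first.
  by apply: P0 => c; rewrite leqNgt ra.
have [b ba bmax] := @arg_maxnP _ b0 (fun b => r b < r a)%N r b0a.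
by apply: (PS a b ba bmax); apply: IH; lia.
Qed.

(** * From WPIP to CIP *)

Section Chains.
Variables (n : nat) (M : maniplex n) (k : nat) (G : 'I_k.+1 -> face M).
Hypothesis G_chain : is_chain G.

Let r a : nat := rank (G a).
Let mem a (u : M) := vert (face_graph (G a)) u.

Lemma chain_meet a b : exists2 u, mem a u & mem b u.
Proof. by case: (G_chain a b) => -[_ [u [ua ub]]]; exists u. Qed.

(** Faces of a chain meet, and two components of the same graph which meet coincide. *)
Lemma chain_rank_eq a b u : r a = r b -> mem a u -> mem b u.
Proof.
move=> /val_inj rab au; have [w aw bw] := chain_meet a b.
by apply/(face_reach _ bw); rewrite -rab; apply/(face_reach _ aw).
Qed.

Lemma far_sides (i j : 'I_n) (m : nat) : (i < m < j)%N -> far i j /\ far j i.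
Proof. by rewrite /far; lia. Qed.

Lemma chain_common_flag a : exists u, forall c, (r c <= r a)%N -> mem c u.
Proof.
elim/(@finite_rank_ind _ r): a => [a amin|a b ba bmax [u um]].
  have [u au _] := chain_meet a a; exists u => c ca.
  by apply: chain_rank_eq au; apply/eqP; rewrite eqn_leq ca amin.
have [w aw bw] := chain_meet a b.
have ub : mem b u by exact: um.
have [x ux xw] : exists2 x, reach [set i : 'I_n | (r b < i)%N] u x &
    reach [set i : 'I_n | (i < r b)%N] x w.
  move/(face_reach _ ub): bw; apply: reach_split => [i j /= ib bj|i /= ib].
    by apply: (far_sides (m := r b) _).1; rewrite ib.
  by case: (ltngtP i (r b)) => [|?|/val_inj/ib //]; [right|left].
have ax : mem a x.
  apply: face_stable (reach_sym xw) aw => /=; rewrite -/(r a); lia.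
exists x => c ca; have [cb|] := ltnP (r c) (r a); last first.
  by move=> ac; apply: chain_rank_eq ax; lia.
have {}cb := bmax c cb.
by apply: face_stable ux (um c cb) => /=; rewrite -/(r c); lia.
Qed.

Lemma chain_reach a u v : WPIP M ->
  (forall c, (r c <= r a)%N -> mem c u) ->
  (forall c, (r c <= r a)%N -> mem c v) ->
  reach [set i | forall c, (r c <= r a)%N -> i <> rank (G c)] u v.
Proof.
move=> wpip.
elim/(@finite_rank_ind _ r): a u v => [a amin|a b ba bmax IH] u v um vm.
  have /(face_reach _ (um a (leqnn _))) := vm a (leqnn _).
  apply: reach_sub => i ia c ca ic; apply: ia => /=; apply: val_inj => /=.
  by rewrite ic; apply/eqP; rewrite eqn_leq ca amin.
have rcE c : (r c <= r a)%N -> (r c <= r b)%N \/ r c = r a.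
  by have := bmax c; lia.
have [x ux xv] : exists2 x, reach [set i : 'I_n | (r b < i)%N] u x &
    reach [set i : 'I_n | (i < r b)%N /\
      forall c, (r c <= r a)%N -> i <> rank (G c)] x v.
  have: reach [set i | forall c, (r c <= r b)%N -> i <> rank (G c)] u v.
    by apply: IH => c cb; [apply: um|apply: vm]; lia.
  apply: reach_split => [i j /= [ib _] bj|i /= ib].
    by apply: (far_sides (m := r b) _).1; rewrite ib.
  case: (ltngtP i (r b)) => [lt_ib|?|/val_inj/(ib _ (leqnn _)) //]; [right|by left].
  split=> // c /rcE[/ib //|ca ic].
  by move: lt_ib; rewrite ic -/(r c); lia.
have ax : mem a x.
  apply: face_stable (reach_sym xv) (vm a (leqnn _)) => /= -[_].
  by move/(_ a (leqnn _)).
have [y uy yx] : exists2 y, reach [set i : 'I_n | (i < r a)%N] u y &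
    reach [set i : 'I_n | (r a < i)%N] y x.
  move/(face_reach _ (um a (leqnn _))): ax.
  apply: reach_split => [i j /= ib bj|i /= ia].
    by apply: (far_sides (m := r a) _).2; rewrite ib bj.
  by case: (ltngtP i (r a)) => [|?|/val_inj/ia //]; [left|right].
(* The detour through [x] works because colours above [r a] are also above [r b]. *)
have uy' : reach [set i : 'I_n | (r b < i)%N] u y.
  by apply: reach_trans ux _; apply: reach_sym; apply: reach_sub yx => i /=; lia.
have {uy uy'}uy : reach [set i : 'I_n | (r b < i < r a)%N] u y.
  have [->|nuy] := pselect (u = y); first exact: reach_refl.
  apply/joined_restrP; apply: (wpip u y (rank (G b)) (rank (G a))) => //.
    exact/joined_restrP.
  exact/joined_restrP.
(* The first piece stays in a gap between consecutive ranks, the second above [r a], and the third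
   avoids the ranks by construction. *)
apply: reach_trans (reach_sub _ uy)
  (reach_trans (reach_sub _ yx) (reach_sub _ xv)).
- by move=> i /= ib c /rcE ca ic; move: ib; rewrite ic -/(r c); lia.
- by move=> i /= ib c /rcE ca ic; move: ib; rewrite ic -/(r c); lia.
- by move=> i [].
Qed.

Lemma chain_connected : WPIP M ->
  connected (bigmeet_graph (fun a => face_graph (G a))).
Proof.
move=> wpip; have [a _ amax] := @arg_maxnP _ (@ord0 k) xpredT r isT.
have {}amax c : (r c <= r a)%N by exact: amax.
split=> [|u v um vm].
  by have [u um] := chain_common_flag a; exists u => c _; apply: um.
apply/bigmeet_face_joined; split=> [c|]; first exact: um.
have := @chain_reach a u v wpip (fun c _ => um c Logic.I) (fun c _ => vm c Logic.I).
by apply: reach_sub => i ia c; apply: ia.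
Qed.

End Chains.

Lemma CIP_WPIP n (M : maniplex n) : CIP M -> WPIP M.
Proof.
case: n M => [M _ u v [//]|n M cip u v i j _ ij].
move=> /joined_restrP iuv /joined_restrP juv.
(* Sending the colours strictly between [i] and [j] to [i] makes the ranks of the family exactly the
   colours outside that interval. *)
pose s (a : 'I_n.+1) := if (i < a < j)%N then i else a.
pose G a := face_at (s a) u.
have G_chain : is_chain G.
  move=> a b; have meet c d : vert (meet_graph (face_graph (G c))
      (face_graph (G d))) !=set0 by exists u; split; apply: face_at_mem.
  by case: (leqP (s a) (s b)) => [?|/ltnW ?]; [left|right]; split.
have [_ /(_ u v)] := cip n G G_chain.
have um a : vert (face_graph (G a)) u by exact: face_at_mem.
have vm a : vert (face_graph (G a)) v.
  have [si|js] : (s a <= i)%N \/ (j <= s a)%N.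
    by rewrite /s; case: ifP; lia.
    by apply: face_stable iuv (um a) => /=; lia.
  by apply: face_stable juv (um a) => /=; lia.
case/(_ (fun a _ => um a) (fun a _ => vm a))/bigmeet_face_joined => _ uv.
apply/joined_restrP; apply: reach_sub uv => c /(_ c) /=.
by rewrite /s; case: ifP.
Qed.

Theorem theorem5p4 (n : nat) (M : maniplex n) : CIP M <-> WPIP M.
Proof.
by split=> [/CIP_WPIP //|wpip k G G_chain]; apply: chain_connected.
Qed.
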